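(* Let $n\ge2$, let $\mathsf{f}\in\mathbb{R}^n$, and let $\mathsf{p}\in\mathbb{R}^n$ be a probability vector with $p_i>0$ for all $i$. For $\varepsilon\ge 0$ let $$V_{\rm TV}(\varepsilon;\mathsf{f})=\max\Big\{\sum_{i=1}^nq_if_i\ \Big|\ \mathsf{q}\in\mathbb{R}^n,\ \sum_{i=1}^n|q_i-p_i|\le\varepsilon,\ \sum_{i=1}^nq_i=1,\ q_i\ge0\ (i=1,\dots,n)\Big\}.$$ Then for every $\varepsilon\in(0,\min_ip_i)$, a maximizer $\mathsf{q}$ (a worst-case probability distribution) is given by $$(q_{(1)},q_{(2)},\dots,q_{(n-1)},q_{(n)})=\Big(p_{(1)}+\frac{\varepsilon}{2},\,p_{(2)},\dots,p_{(n-1)},\,p_{(n)}-\frac{\varepsilon}{2}\Big),$$ and $$V_{\rm TV}(\varepsilon;\mathsf{f})=\mathbb{E}_{\mathsf{p}}(\mathsf{f})+\varepsilon\cdot\frac{\max(\mathsf{f})-\min(\mathsf{f})}{2}.$$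
   Context: The components of $\mathsf{f}$ are ordered from largest to smallest, $f_{(1)}\ge\cdots\ge f_{(n)}$ (ties broken by a fixed ordering); $p_{(i)}$ and $q_{(i)}$ denote the masses that $\mathsf{p}$ and $\mathsf{q}$ put on the index corresponding to $f_{(i)}$. $\mathbb{E}_{\mathsf{p}}(\mathsf{f})=\sum_ip_if_i$, $\max(\mathsf{f})=\max_if_i$, $\min(\mathsf{f})=\min_if_i$. *)

(* Defs.v *)
From HB Require Import structures.
From mathcomp Require Import all_boot all_order all_algebra all_fingroup.
From mathcomp Require Import all_classical all_reals.

Set Implicit Arguments.
Unset Strict Implicit.
Unset Printing Implicit Defensive.

Import Order.TTheory GRing.Theory Num.Theory.
Local Open Scope classical_set_scope.
Local Open Scope ring_scope.

Definition prob_vec (R : realType) (n : nat) (p : 'rV[R]_n) : Prop :=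
  (forall i, 0 <= p 0 i) /\ \sum_i p 0 i = 1.

Definition expect (R : realType) (n : nat) (p f : 'rV[R]_n) : R :=
  \sum_i p 0 i * f 0 i.

(* The default value [x 0 ord0] of the iterated operator is itself an entry. *)
Definition vmax (R : realType) (n : nat) (x : 'rV[R]_n.+1) : R :=
  \big[Num.max/x 0 ord0]_i x 0 i.

Definition vmin (R : realType) (n : nat) (x : 'rV[R]_n.+1) : R :=
  \big[Num.min/x 0 ord0]_i x 0 i.

Definition TV_ball (R : realType) (n : nat) (p : 'rV[R]_n) (eps : R) :
    set 'rV[R]_n :=
  [set q | [/\ \sum_i `|q 0 i - p 0 i| <= eps, \sum_i q 0 i = 1
             & forall i, 0 <= q 0 i]].

(* A worst-case probability distribution. *)
Definition TV_maximizer (R : realType) (n : nat) (p f : 'rV[R]_n) (eps : R)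
    (q : 'rV[R]_n) : Prop :=
  TV_ball p eps q /\
  forall q', TV_ball p eps q' -> expect q' f <= expect q f.

(* Written as a supremum; it is the maximum whenever a maximizer exists
   (lemma V_TV_max below). *)
Definition V_TV (R : realType) (n : nat) (p f : 'rV[R]_n) (eps : R) : R :=
  sup [set expect q f | q in TV_ball p eps].

Lemma V_TV_max (R : realType) (n : nat) (p f : 'rV[R]_n) (eps : R)
    (q : 'rV[R]_n) :
  TV_maximizer p f eps q -> V_TV p f eps = expect q f.
Proof.
move=> [qB qM]; apply/eqP; rewrite eq_le; apply/andP; split.
  apply: ge_sup; first by exists (expect q f), q.
  by move=> _ [q' q'B <-]; apply: qM.
apply: ub_le_sup; last by exists q.
by exists (expect q f) => _ [q' q'B <-]; apply: qM.
Qed.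

(* [s k] is the index of the (k+1)-th largest entry of [f].  The permutations
   satisfying this are exactly the orderings obtained from the possible ways
   of breaking ties. *)
Definition decreasing_order (R : realType) (n : nat) (f : 'rV[R]_n)
    (s : 'S_n) : Prop :=
  forall j k : 'I_n, (j <= k)%N -> f 0 (s k) <= f 0 (s j).

Lemma decreasing_order_exists (R : realType) (n : nat) (f : 'rV[R]_n) :
  exists s : 'S_n, decreasing_order f s.
Proof.
pose r := [rel i j : 'I_n | f 0 j <= f 0 i].
have r_tot : total r by move=> i j; exact: le_total.
have r_tr : transitive r by move=> j i k /= ji kj; exact: le_trans kj ji.
have /tuple_permP[s Es] : perm_eq (sort r (ord_tuple n)) (ord_tuple n).
  by rewrite perm_sort.
exists s => j k; rewrite leq_eqVlt => /predU1P[/val_inj -> //|ltjk].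
have := sort_sorted r_tot (ord_tuple n); rewrite Es => srt.
have := sorted_ltn_nth r_tr j srt.
move=> /(_ j k); rewrite !inE !size_tuple => /(_ (ltn_ord j) (ltn_ord k) ltjk).
by rewrite -!tnth_nth !tnth_mktuple !tnth_ord_tuple.
Qed.

(* The vector q with q_(1) = p_(1) + eps/2, q_(n) = p_(n) - eps/2 and
   q_(k) = p_(k) otherwise; [(s^-1)%g i] is the rank of the index [i]. *)
Definition worst_case (R : realType) (n : nat) (p : 'rV[R]_n.+2) (eps : R)
    (s : 'S_n.+2) : 'rV[R]_n.+2 :=
  \row_i (if (s^-1)%g i == ord0 then p 0 i + eps / 2
          else if (s^-1)%g i == ord_max then p 0 i - eps / 2
          else p 0 i).

(* Main.v *)
(** Moving the mass [eps / 2] from an index [b] minimizing [f] to an index [a]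
    maximizing it gains [eps * ((f a - f b) / 2)].  No [q] in the ball gains
    more: since [q - p] sums to [0], [f] may be centred at [(f a + f b) / 2],
    and the centred [f] is bounded by [(f a - f b) / 2] in absolute value. *)
Require Import Defs.
From mathcomp Require Import all_boot all_order all_algebra all_fingroup.
From mathcomp Require Import all_classical all_reals.
From mathcomp Require Import ring lra.

Import Order.TTheory GRing.Theory Num.Theory.
Local Open Scope ring_scope.

Lemma sum_mul_delta (R : pzRingType) (I : finType) (a : I) (g : I -> R) :
  \sum_i (i == a)%:R * g i = g a.
Proof.
rewrite (bigD1 a) //= eqxx mul1r big1 ?addr0 // => i /negPf ->.
by rewrite mul0r.
Qed.

Lemma sum_delta (R : pzRingType) (I : finType) (a : I) :
  \sum_i (i == a)%:R = 1 :> R.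
Proof.
rewrite -[RHS](sum_mul_delta _ _ a (fun=> 1)).
by under [RHS]eq_bigr do rewrite mulr1.
Qed.

Lemma vmaxE (R : realType) (n : nat) (x : 'rV[R]_n.+1) (a : 'I_n.+1) :
  (forall i, x 0 i <= x 0 a) -> vmax x = x 0 a.
Proof.
move=> ha; apply/eqP; rewrite eq_le; apply/andP; split; last exact: le_bigmax.
(* The default [x 0 ord0] is an entry, so [ha] bounds it as well as the terms. *)
exact: bigmax_le.
Qed.

Lemma vminE (R : realType) (n : nat) (x : 'rV[R]_n.+1) (b : 'I_n.+1) :
  (forall i, x 0 b <= x 0 i) -> vmin x = x 0 b.
Proof.
move=> hb; apply/eqP; rewrite eq_le; apply/andP; split; first exact: bigmin_le.
exact: le_bigmin.
Qed.

Lemma vmin_le (R : realType) (n : nat) (x : 'rV[R]_n.+1) (i : 'I_n.+1) :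
  vmin x <= x 0 i.
Proof. exact: bigmin_le. Qed.

(** With at least two indices, [s ord0] and [s ord_max] differ, so the cases collapse to a
    difference of indicators. This form is linear, so sums over it reduce to [sum_delta] and
    [sum_mul_delta]. *)
Lemma worst_caseE (R : realType) (n : nat) (p : 'rV[R]_n.+2) (eps : R)
    (s : 'S_n.+2) (i : 'I_n.+2) :
  worst_case p eps s 0 i =
  p 0 i + eps / 2 * ((i == s ord0)%:R - (i == s ord_max)%:R).
Proof.
have E j : ((s^-1)%g i == j) = (i == s j).
  by apply/eqP/eqP => [<-|->]; rewrite ?permKV ?permK.
rewrite mxE !E; case: (eqVneq i (s ord0)) => [->|_].
  by rewrite (inj_eq perm_inj) /= subr0 mulr1.
by case: eqP => _ /=; ring.
Qed.

Lemma expect_worst_case (R : realType) (n : nat) (p f : 'rV[R]_n.+2) (eps : R)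
    (s : 'S_n.+2) :
  expect (worst_case p eps s) f =
  expect p f + eps * ((f 0 (s ord0) - f 0 (s ord_max)) / 2).
Proof.
rewrite /expect; under eq_bigr do rewrite worst_caseE mulrDl -mulrA mulrBl.
rewrite big_split /= -mulr_sumr sumrB !sum_mul_delta; ring.
Qed.

Lemma worst_case_TV_ball (R : realType) (n : nat) (p : 'rV[R]_n.+2) (eps : R)
    (s : 'S_n.+2) :
  \sum_i p 0 i = 1 -> 0 <= eps -> (forall i, eps / 2 <= p 0 i) ->
  TV_ball p eps (worst_case p eps s).
Proof.
move=> p1 eps0 epsp; split.
- have sE i : `|worst_case p eps s 0 i - p 0 i| =
      eps / 2 * ((i == s ord0)%:R + (i == s ord_max)%:R).
    rewrite worst_caseE [p 0 i + _]addrC addrK normrM ger0_norm ?divr_ge0 //.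
    (* At most one of the two indicators is nonzero, so the absolute value of their difference is
       their sum. *)
    case: (eqVneq i (s ord0)) => [->|_].
      by rewrite (inj_eq perm_inj) /= subr0 addr0 normr1.
    by rewrite sub0r add0r normrN normr_nat.
  under eq_bigr do rewrite sE.
  by rewrite -mulr_sumr big_split /= !sum_delta; lra.
- under eq_bigr do rewrite worst_caseE.
  by rewrite big_split /= -mulr_sumr sumrB !sum_delta p1 subrr mulr0 addr0.
- move=> i; rewrite worst_caseE; have := epsp i.
  by case: (_ == s ord0); case: (_ == s ord_max) => /=; lra.
Qed.

Lemma expect_TV_ball_le (R : realType) (n : nat) (p q f : 'rV[R]_n)
    (eps m M : R) :
  \sum_i p 0 i = 1 -> m <= M -> (forall i, m <= f 0 i <= M) ->
  TV_ball p eps q -> expect q f <= expect p f + eps * ((M - m) / 2).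
Proof.
move=> p1 mM fmM [qp q1 _]; rewrite -lerBlDl.
have -> : expect q f - expect p f =
    \sum_i (q 0 i - p 0 i) * (f 0 i - (M + m) / 2).
  (* The centring constant contributes a multiple of the total mass of [q - p], which is 0. *)
  under [RHS]eq_bigr do rewrite mulrBr mulrBl.
  by rewrite !sumrB -mulr_suml sumrB p1 q1 subrr mul0r subr0.
have c0 : 0 <= (M - m) / 2 by lra.
(* Hölder's inequality for the l1 and sup norms, proved term by term: the l1 norm of [q - p] is
   within the budget [eps]. *)
apply: le_trans (ler_wpM2r c0 qp); rewrite mulr_suml; apply: ler_sum => i _.
apply: (le_trans (ler_norm _)); rewrite normrM; apply: ler_wpM2l => //.
by rewrite ler_norml; have /andP[] := fmM i; lra.
Qed.

Theorem propositionC2 (R : realType) (n : nat) (f p : 'rV[R]_n.+2)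
    (p_prob : prob_vec p) (p_pos : forall i, 0 < p 0 i)
    (eps : R) (eps_gt0 : 0 < eps) (eps_lt : eps < vmin p) :
  (forall s : 'S_n.+2, decreasing_order f s ->
     TV_maximizer p f eps (worst_case p eps s)) /\
  V_TV p f eps = expect p f + eps * ((vmax f - vmin f) / 2).
Proof.
have p1 : \sum_i p 0 i = 1 by case: p_prob.
have fmax s : decreasing_order f s -> forall i, f 0 i <= f 0 (s ord0).
  (* Writing [i] as [s] of its rank turns the claim into a comparison of that rank with [ord0]. *)
  by move=> fs i; rewrite -(permKV s i); apply: fs.
have fmin s : decreasing_order f s -> forall i, f 0 (s ord_max) <= f 0 i.
  by move=> fs i; rewrite -(permKV s i); apply: fs; exact: leq_ord.
have wcM s : decreasing_order f s ->
    TV_maximizer p f eps (worst_case p eps s).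
  move=> fs; split.
    apply: worst_case_TV_ball => [//||i]; first exact: ltW.
    by have := vmin_le _ _ p i; lra.
  move=> q qB; rewrite expect_worst_case.
  apply: expect_TV_ball_le => // [|i]; first exact: fmin.
  by rewrite fmin ?fmax.
(* The value involves no ordering, so any one [s] computes it, however ties are broken. *)
split=> //; have [s fs] := decreasing_order_exists f.
by rewrite (V_TV_max (wcM s fs)) expect_worst_case
  (vmaxE _ _ _ _ (fmax s fs)) (vminE _ _ _ _ (fmin s fs)).
Qed.
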